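(* Consider a system of recurrence relations of the form $x_{k+1}=Kx_k$, $k\in\mathbb Z$, where $x_k\in\mathbb F^n$ and $K\in\mathcal M_n(\mathbb F)$ is invertible. Define $$\overline H_{k,j}:=\begin{cases}K^{k-1-j}, & -1\leqslant j\leqslant k-1,\\ -K^{k-1-j}, & k\leqslant j\leqslant -1,\\ 0, & \text{otherwise.}\end{cases}$$ Then $\overline H:=(\overline H_{k,j})_{k,j\in\mathbb Z}$ is a Green's function of the system $x_{k+1}=Kx_k$, $k\in\mathbb Z$; that is, a solution of $$x_{k+1}=Kx_k+c_k,\quad k\in\mathbb Z,$$ where $c=(c_k)_{k\in\mathbb Z}\in\mathcal F(\mathbb Z,\mathbb F^n)$, is given by $u=\overline Hc$.
   Context: $\mathbb F$ is a field, $n\in\mathbb N$, $\mathcal M_n(\mathbb F)$ is the set of $n\times n$ matrices with entries in $\mathbb F$, and $\mathcal F(\mathbb Z,\mathbb F^n)$ is the space of functions from $\mathbb Z$ to $\mathbb F^n$, that is, of sequences $(c_k)_{k\in\mathbb Z}$ with $c_k\in\mathbb F^n$. For such a sequence $c$, $\overline Hc$ denotes the sequence $(\overline Hc)_k:=\sum_{j\in\mathbb Z}\overline H_{k,j}c_j$, $k\in\mathbb Z$, which is a finite sum for each $k$.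
   Formalization: As printed the claim fails at k = -1 when c_{-1} ≠ 0, since column j = -1 appears in both cases; it is proved for both one-bound corrections: 0 ≤ j ≤ k-1 with k ≤ j ≤ -1, and -1 ≤ j ≤ k-1 with k ≤ j ≤ -2 (n ≥ 1). *)

(* Defs.v *)
From HB Require Import structures.
From mathcomp Require Import all_boot all_order all_algebra.
From mathcomp Require Import classical_sets cardinality fsbigop.

Set Implicit Arguments.
Unset Strict Implicit.
Unset Printing Implicit Defensive.

Import Order.TTheory GRing.Theory Num.Theory.
Local Open Scope classical_set_scope.
Local Open Scope ring_scope.

(* The dimension is n.+1, so that 'M[F]_n.+1 is a unit ring and K ^ z is the
   library's power with an integer exponent. *)

(* (H c)_k = \sum_(j in Z) H_(k, j) c_j.  The sum is 0 by convention when
   infinitely many terms are nonzero; row_finite excludes this case. *)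
Definition kernel_app (F : fieldType) (n : nat) (H : int -> int -> 'M[F]_n.+1)
    (c : int -> 'cV[F]_n.+1) (k : int) : 'cV[F]_n.+1 :=
  \sum_(j \in [set: int]) (H k j *m c j).

Definition row_finite (F : fieldType) (n : nat)
    (H : int -> int -> 'M[F]_n.+1) : Prop :=
  forall k : int, finite_set [set j : int | H k j != 0].

Definition solution (F : fieldType) (n : nat) (K : 'M[F]_n.+1)
    (c x : int -> 'cV[F]_n.+1) : Prop :=
  forall k : int, x (k + 1) = K *m x k + c k.

Definition green_function (F : fieldType) (n : nat) (K : 'M[F]_n.+1)
    (H : int -> int -> 'M[F]_n.+1) : Prop :=
  row_finite H /\
  forall c : int -> 'cV[F]_n.+1, solution K c (kernel_app H c).

(* The source prints a = b = -1, which is off by one at j = -1: the column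
   j = -1 is then nonzero on both sides of the diagonal, and printed_not_green
   shows that for invertible K the result is never a Green's function.  Changing either bound by
   one repairs it: (a, b) = (0, -1) makes the solution vanish at k = 0, and
   (a, b) = (-1, -2) makes it vanish at k = -1. *)
Definition Hbar (F : fieldType) (n : nat) (a b : int) (K : 'M[F]_n.+1)
    (k j : int) : 'M[F]_n.+1 :=
  if a <= j <= k - 1 then K ^ (k - 1 - j)
  else if k <= j <= b then - K ^ (k - 1 - j)
  else 0.

Lemma printed_not_green (F : fieldType) (n : nat) (K : 'M[F]_n.+1) :
  K \in unitmx -> ~ green_function K (Hbar (-1) (-1) K).
Proof.
move=> Ku [_ /(_ (fun j => if j == -1 then const_mx 1 else 0) (-1))].
have E k : kernel_app (Hbar (-1) (-1) K)
    (fun j => if j == -1 then const_mx 1 else 0) k =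
    Hbar (-1) (-1) K k (-1) *m const_mx 1.
  rewrite /kernel_app -(@fsbig_widen _ _ 0 _ [set -1]) ?fsbig_set1 ?eqxx //.
  by move=> j [_ /= /eqP/negbTE ->]; rewrite mulmx0.
rewrite !E eqxx /Hbar /= expr0z mul1mx mulmxA mulmxN.
rewrite -[K *m _]/(K * K ^ (-1)) exprN1 mulrV // mulNmx mul1mx addNr.
by move=> /matrixP/(_ ord0 ord0)/eqP; rewrite !mxE oner_eq0.
Qed.

(* Main.v *)
Require Import Defs.
From mathcomp Require Import all_boot all_order all_algebra.
From mathcomp Require Import classical_sets cardinality fsbigop.
From mathcomp Require Import zify.

(** A kernel whose entries satisfy [H (k + 1) j = K *m H k j + (j == k)%:R%:M],
    that is, whose [j]-th column solves the recurrence with right-hand side a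
    unit impulse at time [j], is a Green's function: multiplying by [c j] and
    summing over [j] superposes the impulse responses, and the impulse terms
    sum to [c k] (green_function_of_impulse_response).  Finiteness of the rows
    is what allows the sum to be split.

    In the explicit kernel, each column is on its support a power of [K], up
    to sign, gaining one factor [K] per time step.  The cutoff [a] separates
    the columns [a <= j], which are zero up to time [j] and equal to the
    identity at time [j + 1], from the columns [j < a], which are zero after
    time [j] and equal to [- K ^ (-1)] at time [j], so that the impulse cancels
    [K *m (- K ^ (-1))].  In both cases the jump is exactly one identity
    matrix, whatever the cutoff (Hbar_impulse_response), so the two kernels
    of the theorem are the instances [a = 0] and [a = -1]. *)

Import GRing.Theory Num.Theory Order.TTheory.
Local Open Scope classical_set_scope.
Local Open Scope ring_scope.

Lemma finite_int_itv (a b : int) : finite_set [set j : int | a <= j <= b].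
Proof.
apply: (@sub_finite_set _ _ ((fun m : nat => a + m%:Z) @` `I_(absz (b - a)).+1)).
  move=> j /= /andP[aj jb]; exists (absz (j - a)) => /=; lia.
exact/finite_image/finite_II.
Qed.

(** The rows [k] and [k + 1] and the impulse at [k] have finite supports, so
    all three sums are taken over one common finite index set. *)
Lemma green_function_of_impulse_response (F : fieldType) (n : nat)
    (K : 'M[F]_n.+1) (H : int -> int -> 'M[F]_n.+1) :
  row_finite H ->
  (forall k j, H (k + 1) j = K *m H k j + (j == k)%:R%:M) ->
  green_function K H.
Proof.
move=> Hfin Hstep; split=> // c k.
pose S := [set j | H k j != 0] `|` [set k].
have Sfin : finite_set S by rewrite finite_setU; split=> //; exact: finite_set1.
have offS j : ~ S j -> H k j = 0 /\ (j == k) = false.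
  move=> nSj; split; last by apply/eqP => jk; apply: nSj; right.
  by apply/eqP/negP => /negP Hkj; apply: nSj; left.
have restrict (f : int -> 'cV[F]_n.+1) : (forall j, ~ S j -> f j = 0) ->
    \sum_(j \in [set: int]) f j = \sum_(j \in S) f j.
  by move=> f0; apply/esym/fsbig_widen => // j [_ /f0].
rewrite /kernel_app !restrict; first last.
- by move=> j /offS[Hkj jk]; rewrite Hstep Hkj jk mulmx0 add0r raddf0 mul0mx.
- by move=> j /offS[-> _]; rewrite mul0mx.
have -> : c k = \sum_(j \in S) ((j == k)%:R *: c j).
  rewrite -(@fsbig_widen _ _ 0 _ [set k] S); first last.
  - by move=> j [_ /= /eqP/negbTE ->]; rewrite scale0r.
  - by move=> j ->; right.
  by rewrite fsbig_set1 eqxx scale1r.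
rewrite !fsbig_finite //= mulmx_sumr -big_split /=.
by apply: eq_bigr => j _; rewrite Hstep mulmxDl mulmxA mul_scalar_mx.
Qed.

Lemma Hbar_row_finite (F : fieldType) (n : nat) (a b : int) (K : 'M[F]_n.+1) :
  row_finite (Hbar a b K).
Proof.
move=> k; apply: (@sub_finite_set _ _
  ([set j | a <= j <= k - 1] `|` [set j | k <= j <= b])).
  move=> j /=; rewrite /Hbar; case: ifP => [? _|_]; first by left.
  by case: ifP => [? _|_]; [right | rewrite eqxx].
by rewrite finite_setU; split; exact: finite_int_itv.
Qed.

(** With [a - 1] as second bound, every column is nonzero on exactly one side
    of its impulse time, which makes the jump there the identity. *)
Lemma Hbar_impulse_response (F : fieldType) (n : nat) (a : int)
    (K : 'M[F]_n.+1) (k j : int) : K \in unitmx ->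
  Hbar a (a - 1) K (k + 1) j = K *m Hbar a (a - 1) K k j + (j == k)%:R%:M.
Proof.
move=> Ku; have stepK m : K ^ (m + 1) = K *m K ^ m.
  by rewrite addrC exprzDr.
have -> : Hbar a (a - 1) K (k + 1) j =
  if a <= j <= k then K *m K ^ (k - 1 - j)
  else if k + 1 <= j <= a - 1 then - (K *m K ^ (k - 1 - j)) else 0.
  by rewrite /Hbar addrK -stepK (_ : k - 1 - j + 1 = k - j) //; lia.
rewrite /Hbar; have [->|jk] := eqVneq j k.
  have KK1 : K *m K ^ (k - 1 - k) = 1%:M.
    by rewrite -stepK (_ : _ + 1 = 0) //; lia.
  have -> : (a <= k <= k - 1) = false by lia.
  have -> : (k + 1 <= k <= a - 1) = false by lia.
  rewrite !lexx andbT /=; case: leP => ak.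
    by rewrite (_ : (k <= a - 1) = false) ?mulmx0 ?add0r //; lia.
  by rewrite (_ : (k <= a - 1) = true) ?mulmxN ?KK1 ?addNr //; lia.
rewrite raddf0 addr0.
have -> : (j <= k) = (j <= k - 1) by lia.
have -> : (k + 1 <= j) = (k <= j) by lia.
by case: ifP => // _; case: ifP => _; rewrite ?mulmxN ?mulmx0.
Qed.

Lemma Hbar_green_function (F : fieldType) (n : nat) (a : int)
    (K : 'M[F]_n.+1) : K \in unitmx -> green_function K (Hbar a (a - 1) K).
Proof.
move=> Ku; apply: green_function_of_impulse_response => [|k j].
  exact: Hbar_row_finite.
exact: Hbar_impulse_response.
Qed.

Theorem theorem4p4 (F : fieldType) (n : nat) (K : 'M[F]_n.+1)
    (K_inv : K \in unitmx) :
  green_function K (Hbar 0 (-1) K) /\ green_function K (Hbar (-1) (-2) K).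
Proof.
split; first exact: (@Hbar_green_function F n 0).
exact: (@Hbar_green_function F n (-1)).
Qed.
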